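(* Let $\varepsilon \in (0,1)$, let $k$ be an integer, let $\mathcal{H}$ be a good family of graphs, and let $\ell$ be a positive integer satisfying \[ \frac{\mathrm{ex}(\lceil 6\ell/\varepsilon \rceil, \mathcal{H})}{\ell} \le \frac{k}{2}. \] If $G$ is a finite $\mathcal{H}$-free graph with minimum degree at least $k$ and $p \in [0,1]$ satisfies $p \ge \frac{1+\varepsilon}{k}$, then \[ \Pr\big(G_p \text{ contains a path of length } \ell\big) \ge 1 - 3\exp\left(-\frac{\varepsilon^3 k}{300}\right). \]
   Context: A family $\mathcal{H}$ of graphs is called good if it is a finite (possibly empty) collection of connected graphs, each of which contains a cycle. A graph is $\mathcal{H}$-free if it contains no copy of any $H \in \mathcal{H}$ as a subgraph. $\mathrm{ex}(n,\mathcal{H})$ denotes the maximum number of edges in an $\mathcal{H}$-free graph on $n$ vertices. For a graph $G$ and $p \in [0,1]$, $G_p$ is the random spanning subgraph of $G$ obtained by keeping each edge of $G$ independently with probability $p$. The length of a path is its number of edges. *)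

(* Defs.v *)
From HB Require Import structures.
From mathcomp Require Import all_boot all_order all_algebra.
From mathcomp Require Import reals.

Set Implicit Arguments.
Unset Strict Implicit.
Unset Printing Implicit Defensive.

Import Order.TTheory GRing.Theory Num.Theory.

(* A simple graph on V is given by its edges, unordered pairs of distinct
   vertices; sgraph V is the finite type of all labelled graphs on V. *)
Record sgraph (V : finType) := SGraph {
  edges : {set {set V}};
  edges_card2 : [forall e in edges, #|e| == 2]
}.

HB.instance Definition _ (V : finType) := [isSub for @edges V].
HB.instance Definition _ (V : finType) := [Finite of sgraph V by <:].

Section Graphs.

Variable V : finType.
Implicit Types G F : sgraph V.

(* Irreflexive, since [set x; x] is a singleton. *)
Definition adj G : rel V := fun x y => [set x; y] \in edges G.

Definition degree G (x : V) : nat := #|[set y | adj G x y]|.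

(* Every degree is smaller than #|V|, so the default value #|V| only matters
   for the graph without vertices, whose minimum degree is 0. *)
Definition min_degree G : nat := \big[minn/#|V|]_(x : V) degree G x.

Definition connected_graph G : Prop := forall x y : V, connect (adj G) x y.

(* 'cycle' accepts the closed walks x, y, x of length 2, whence the bound on
   the size. *)
Definition contains_cycle G : Prop :=
  exists c : seq V, [/\ 2 < size c, uniq c & cycle (adj G) c].

(* A path of length l, counted in edges, has l.+1 distinct vertices. *)
Definition contains_path (l : nat) G : bool :=
  [exists s : l.+1.-tuple V, uniq s && sorted (adj G) s].

End Graphs.

(* G has a subgraph, not necessarily induced, isomorphic to H. *)
Definition contains_copy (U V : finType) (H : sgraph U) (G : sgraph V) : bool :=
  [exists f : {ffun U -> V},
    injectiveb f && [forall x, forall y, adj H x y ==> adj G (f x) (f y)]].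

(* A finite collection of graphs is indexed by a finite type I, which may be
   empty; H i has vertex set U i. *)
Section Families.

Variables (I : finType) (U : I -> finType) (H : forall i, sgraph (U i)).

Definition good_family : Prop :=
  forall i, connected_graph (H i) /\ contains_cycle (H i).

Definition family_free (V : finType) (G : sgraph V) : bool :=
  [forall i, ~~ contains_copy (H i) G].

(* For a good family the edgeless graph is free, so that this is a maximum
   over a nonempty set. *)
Definition ex_num (n : nat) : nat :=
  \max_(G : sgraph 'I_n | family_free G) #|edges G|.

End Families.

Section RandomSubgraph.

Local Open Scope ring_scope.

Variables (R : realType) (V : finType) (p : R) (G : sgraph V).

(* Pr (G_p = F), for a spanning subgraph F of G *)
Definition Gp_weight (F : sgraph V) : R :=
  \prod_(e in edges G) (if e \in edges F then p else 1 - p).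

(* Pr (G_p satisfies A) *)
Definition Gp_prob (A : pred (sgraph V)) : R :=
  \sum_(F : sgraph V | (edges F \subset edges G) && A F) Gp_weight F.

End RandomSubgraph.

(* Main.v *)
(* Explore G_p by depth-first search, exposing an edge only when the top of the
   stack still has an unexposed edge to an unvisited vertex, until m vertices
   have been visited.  The stack is always a path of G_p.  If it never has more
   than l vertices, then at least m - l vertices are fully explored, so that all
   edges of G from them to the unvisited vertices have been exposed; when m-sets
   of vertices span few edges, this is about k (m - l) edges.  But each present
   edge visits a new vertex, so at most m of the exposed edges are present,
   which is unlikely by a Chernoff bound since p k >= 1 + eps.
   With m = ceil(6 l / eps), freeness bounds the edges spanned by m-sets; if this
   m is too small compared with eps k for the desired probability, the trivial
   bound m^2 is used with m = ceil(7 eps k / 50).  That G has at least m vertices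
   holds because otherwise disjoint copies of G, still free as the forbidden
   graphs are connected, would have too many edges. *)

Require Import Defs.
From mathcomp Require Import all_boot all_order all_algebra.
From mathcomp Require Import reals sequences exp.
From mathcomp Require Import zify ring lra.

Set Implicit Arguments.
Unset Strict Implicit.
Unset Printing Implicit Defensive.

Import Order.TTheory GRing.Theory Num.Theory.
Local Open Scope ring_scope.

(** * Edges and degrees of simple graphs *)

Lemma adjC (V : finType) (G : sgraph V) : symmetric (adj G).
Proof. by move=> x y; rewrite /adj setUC. Qed.

Lemma card_edge (V : finType) (G : sgraph V) e : e \in edges G -> #|e| = 2.
Proof. by move=> eG; have /forall_inP/(_ e eG)/eqP := edges_card2 G. Qed.

Lemma adj_irr (V : finType) (G : sgraph V) : irreflexive (adj G).
Proof.
by move=> x; apply/negP => /card_edge; rewrite setUid cards1.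
Qed.

Lemma edges_surj (V : finType) (E : {set {set V}}) :
  {in E, forall e : {set V}, #|e| = 2} -> exists F : sgraph V, edges F = E.
Proof.
move=> E2; have E2' : [forall e in E, #|e| == 2].
  by apply/forall_inP => e /E2 ->.
by exists (SGraph E2').
Qed.

Lemma set2_eq (V : finType) (a b x y : V) :
  [set a; b] = [set x; y] -> a = x /\ b = y \/ a = y /\ b = x.
Proof.
move=> eq; have: a \in [set x; y] by rewrite -eq set21.
have: b \in [set x; y] by rewrite -eq set22.
have: x \in [set a; b] by rewrite eq set21.
have: y \in [set a; b] by rewrite eq set22.
rewrite !inE.
by do 4 (case/orP => /eqP ?; subst); auto.
Qed.

Lemma sgraph_of_rel (V : finType) (e : rel V) :
  symmetric e -> irreflexive e -> exists F : sgraph V, adj F =2 e.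
Proof.
move=> eC eirr.
have [|F FE] := @edges_surj V [set [set u.1; u.2] | u in [pred u | e u.1 u.2]].
  move=> _ /imsetP[[x y] /= exy ->]; rewrite cards2.
  by have [xy|//] := eqVneq x y; rewrite xy inE /= eirr in exy.
exists F => x y; rewrite /adj FE; apply/imsetP/idP => [[[a b] /=]|exy].
  by rewrite inE /= => eab /set2_eq[[-> ->]//|[-> ->]]; rewrite eC.
by exists (x, y).
Qed.

Lemma degree_card_edges (V : finType) (G : sgraph V) x :
  degree G x = #|[set e in edges G | x \in e]|.
Proof.
rewrite /degree -(card_in_imset (f := fun y => [set x; y])) => [|y z]; last first.
  rewrite !inE => xy xz /set2_eq[[_ ->]//|[xz' yx]].
  by rewrite yx adj_irr in xy.
apply: eq_card => e; rewrite inE; apply/imsetP/andP => [[y]|[eG xe]].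
  by rewrite inE => xy ->; split; [exact: xy | exact: set21].
have /eqP/cards2P[a [b [_ eE]]] := card_edge eG; move: xe eG.
rewrite eE in_set2 => /orP[]/eqP -> eG; first by exists b; rewrite ?inE.
by exists a; rewrite 1?setUC // inE /adj setUC.
Qed.

Lemma sum_degree (V : finType) (G : sgraph V) :
  (\sum_x degree G x = #|edges G| * 2)%N.
Proof.
under eq_bigr => x _ do rewrite degree_card_edges -sum1dep_card.
rewrite (exchange_big_dep (mem (edges G))) /=; last by move=> x e _ /andP[].
rewrite -sum_nat_const; apply: eq_bigr => e eG.
by rewrite -[RHS](card_edge eG) -sum1_card; apply: eq_bigl => x; rewrite eG.
Qed.

Lemma min_degree_le (V : finType) (G : sgraph V) x : (min_degree G <= degree G x)%N.
Proof.
rewrite /min_degree; have := mem_index_enum x.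
elim: (index_enum V) => // y s IHs; rewrite inE big_cons geq_min.
by case/predU1P => [->|/IHs ->]; rewrite ?leqnn ?orbT.
Qed.

(** * Edge counts in free graphs *)

(* The graph is a union of disjoint pieces, one for each value of b, on each of
   which f embeds it into G; a connected graph lies in a single piece. *)
Lemma ex_num_pullback (I : finType) (U : I -> finType)
    (H : forall i, sgraph (U i)) (V : finType) (G : sgraph V) (m : nat)
    (T : eqType) (b : 'I_m -> T) (f : 'I_m -> V) :
  (forall i, connected_graph (H i)) -> family_free H G ->
  (forall i j, b i = b j -> f i = f j -> i = j) ->
  (\sum_i #|[set j | (b i == b j) && adj G (f i) (f j)]| <= ex_num H m * 2)%N.
Proof.
move=> Hconn Gfree inj_f.
have [||F FE] := @sgraph_of_rel _ (fun i j => (b i == b j) && adj G (f i) (f j)).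
- by move=> i j; rewrite eq_sym adjC.
- by move=> i; rewrite adj_irr andbF.
have Ffree : family_free H F.
  apply/forallP => i; apply: contra (forallP Gfree i).
  case/existsP => g /andP[/injectiveP g_inj /forallP gH].
  have {}gH x y : adj (H i) x y -> adj F (g x) (g y).
    by move: x y => x y; apply/implyP/(forallP (gH x)).
  have bg x y : b (g x) = b (g y).
    have /connectP[p + ->] := Hconn i x y.
    elim: p x => //= z p IHp x /andP[/gH + /IHp <-].
    by rewrite FE => /andP[/eqP].
  apply/existsP; exists [ffun x => f (g x)]; apply/andP; split.
    by apply/injectiveP => x y; rewrite !ffunE => /(inj_f _ _ (bg x y))/g_inj.
  apply/forallP => x; apply/forallP => y; apply/implyP => /gH.
  by rewrite FE !ffunE => /andP[].
have <- : (\sum_i degree F i = \sum_i #|[set j | (b i == b j) && adj G (f i) (f j)]|)%N.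
  by apply: eq_bigr => i _; apply: eq_card => j; rewrite !inE FE.
rewrite sum_degree leq_mul2r /=.
exact: (leq_bigmax_cond (F := fun F : sgraph 'I_m => #|edges F|)).
Qed.

(** A single piece, embedded by an enumeration of [W]. Each edge inside [W] is counted from both
    ends, whence the factor 2. *)
Lemma sum_inner_degree_le (I : finType) (U : I -> finType)
    (H : forall i, sgraph (U i)) (V : finType) (G : sgraph V) (W : {set V}) :
  (forall i, connected_graph (H i)) -> family_free H G ->
  (\sum_(x in W) #|[set y in W | adj G x y]| <= ex_num H #|W| * 2)%N.
Proof.
move=> Hconn Gfree.
have /= := @ex_num_pullback _ _ H V G #|W| unit (fun=> tt)
  (fun i : 'I_#|W| => enum_val i) Hconn Gfree (fun i j _ => @enum_val_inj _ _ i j).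
apply: leq_trans; rewrite big_enum_val; apply: leq_sum => i _.
rewrite -(card_imset _ (@enum_val_inj _ (mem W))); apply: subset_leq_card.
apply/subsetP => y; rewrite inE => /andP[yW xy].
apply/imsetP; exists (enum_rank_in yW y); last by rewrite enum_rankK_in.
by rewrite inE /= enum_rankK_in.
Qed.

(* Fill the vertex set 'I_m with disjoint copies of G. *)
Lemma ex_num_copies (I : finType) (U : I -> finType)
    (H : forall i, sgraph (U i)) (V : finType) (G : sgraph V) (k m : nat) :
  (forall i, connected_graph (H i)) -> family_free H G ->
  (0 < #|V|)%N -> (forall x, k <= degree G x)%N ->
  (m %/ #|V| * #|V| * k <= ex_num H m * 2)%N.
Proof.
move=> Hconn Gfree V0 degG; set v := #|V|.
pose f (i : 'I_m) : V := enum_val (Ordinal (ltn_pmod i V0)).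
pose b (i : 'I_m) := (i %/ v)%N.
have inj_f i j : b i = b j -> f i = f j -> i = j.
  move=> bij /enum_val_inj[mij]; apply: val_inj => /=.
  by rewrite (divn_eq i v) (divn_eq j v) -/(b i) bij mij.
apply: leq_trans (ex_num_pullback Hconn Gfree inj_f).
set q := (m %/ v * v)%N; have qm : (q <= m)%N by exact: leq_trunc_div.
rewrite (bigID (fun i : 'I_m => i < q)%N) /= -[leqLHS]addn0 leq_add //.
rewrite -[q in leqLHS](card_ord q) -sum_nat_const.
rewrite (big_ord_narrow qm) /=; apply: leq_sum => i _.
apply: leq_trans (degG (f (widen_ord qm i))) _.
rewrite /degree -(card_in_imset (D := [set y | _]) (f := f)); last first.
  by move=> j j'; rewrite !inE => /andP[/eqP bj _] /andP[/eqP bj' _]; apply: inj_f; rewrite -bj -bj'.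
apply: subset_leq_card; apply/subsetP => y; rewrite inE => xy.
have jm : (i %/ v * v + enum_rank y < m)%N.
  apply: leq_trans (qm); rewrite /q.
  have iq : (i %/ v < m %/ v)%N by rewrite ltn_divLR.
  apply: (@leq_trans (i %/ v * v + v)); first by rewrite ltn_add2l; apply: ltn_ord.
  by rewrite addnC -mulSn leq_mul2r iq orbT.
have fj : f (Ordinal jm) = y.
  rewrite -[RHS]enum_rankK /f; congr enum_val; apply: val_inj => /=.
  by rewrite modnMDl modn_small.
apply/imsetP; exists (Ordinal jm); last by rewrite fj.
rewrite inE fj xy andbT /b /=.
by rewrite divnMDl // [X in (_ + X)%N]divn_small ?addn0 //; apply: ltn_ord.
Qed.

(** * Probabilities of partially exposed random subgraphs *)

Section Cylinders.

Variables (R : realType) (V : finType) (G : sgraph V) (p : R).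
Hypothesis p01 : 0 <= p <= 1.
Implicit Types (B : pred (sgraph V)) (D A : {set {set V}}).

Let p_ge0 : 0 <= p. Proof. by case/andP: p01. Qed.
Let q_ge0 : 0 <= 1 - p. Proof. by case/andP: p01; rewrite subr_ge0. Qed.

(** A joint rather than a conditional probability, since some outcomes [A] on [D] have probability 0
    when [p] is 0 or 1. *)
Definition cyl_prob B D A : R :=
  Gp_prob p G [pred F | (edges F :&: D == A) && B F].

Definition cyl_weight D A : R := p ^+ #|A| * (1 - p) ^+ #|D :\: A|.

Lemma cyl_weight_ge0 D A : 0 <= cyl_weight D A.
Proof. by rewrite mulr_ge0 ?exprn_ge0. Qed.

Lemma Gp_prob_ge0 B : 0 <= Gp_prob p G B.
Proof. by apply: sumr_ge0 => F _; apply: prodr_ge0 => e _; case: ifP. Qed.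

Lemma cyl_probT B : cyl_prob B set0 set0 = Gp_prob p G B.
Proof. by apply: eq_bigl => F /=; rewrite setI0 eqxx. Qed.

Lemma cyl_weight_query D A e : e \notin D -> A \subset D ->
  (cyl_weight (e |: D) (e |: A) = p * cyl_weight D A) *
  (cyl_weight (e |: D) A = (1 - p) * cyl_weight D A).
Proof.
move=> eD AD; have eA : e \notin A by apply: contra eD => /(subsetP AD).
rewrite /cyl_weight; split.
  have -> : (e |: D) :\: (e |: A) = D :\: A.
    apply/setP => x; rewrite !inE negb_or.
    by have [->|] := eqVneq x e; rewrite /= ?(negPf eD) ?andbF.
  by rewrite cardsU1 eA add1n exprS mulrA.
have -> : (e |: D) :\: A = e |: (D :\: A).
  by apply/setP => x; rewrite !inE; case: eqVneq => // ->; rewrite eA.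
by rewrite cardsU1 !inE (negPf eD) andbF /= add1n exprS mulrCA.
Qed.

Lemma setI_query (X D A : {set {set V}}) e : e \notin D -> A \subset D ->
  ((X :&: (e |: D) == e |: A) = (e \in X) && (X :&: D == A)) *
  ((X :&: (e |: D) == A) = (e \notin X) && (X :&: D == A)).
Proof.
move=> eD AD; have eA : e \notin A by apply: contra eD => /(subsetP AD).
have XDe : e \notin X :&: D by rewrite inE (negPf eD) andbF.
rewrite setIUr; have [eX|eX] := boolP (e \in X) => /=.
  rewrite (setIidPr _) ?sub1set //; split.
    by apply/eqP/eqP => [/(congr1 (fun Y => Y :\ e))|->//]; rewrite !setU1K.
  by apply: contraNF eA => /eqP <-; rewrite setU11.
have -> : X :&: [set e] = set0.
  by apply/eqP; rewrite setI_eq0 disjoint_sym disjoints1.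
rewrite set0U; split=> //; apply: contraNF XDe => /eqP ->; exact: setU11.
Qed.

Lemma cyl_prob_query B D A e : e \notin D -> A \subset D ->
  cyl_prob B D A = cyl_prob B (e |: D) (e |: A) + cyl_prob B (e |: D) A.
Proof.
move=> eD AD; rewrite /cyl_prob /Gp_prob (bigID (fun F => e \in edges F)) /=.
by congr (_ + _); apply: eq_bigl => F; rewrite !(setI_query _ eD AD);
  case: (e \in edges F); rewrite ?andbT ?andbF.
Qed.

(** Induction on the number of unexposed edges: exposing one more splits the weight into shares [p]
    and [1 - p]; once all are exposed, a single graph remains. *)
Lemma cyl_prob_predT D A : A \subset D -> D \subset edges G ->
  cyl_prob predT D A = cyl_weight D A.
Proof.
move=> AD DG; have [n] := ubnP #|edges G :\: D|.
elim: n D A AD DG => // n IHn D A AD DG; rewrite ltnS => Dn.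
have [GD|/subsetPn[e eG eD]] := boolP (edges G \subset D); last first.
  have eDG : e |: D \subset edges G by rewrite subUset sub1set eG.
  have lt_n : (#|edges G :\: (e |: D)| < n)%N.
    rewrite setUC -setDDl; apply: leq_trans Dn.
    by rewrite [ltnRHS](cardsD1 e) inE eD eG.
  rewrite (cyl_prob_query _ eD AD) !IHn // ?(subset_trans AD) ?subsetUr ?setUS //.
  by rewrite !(cyl_weight_query eD AD) -mulrDl addrC subrK mul1r.
have {GD DG}DG : D = edges G by apply/eqP; rewrite eqEsubset DG.
rewrite {}DG in AD *.
have [|F FA] := @edges_surj V A.
  by move=> e /(subsetP AD)/card_edge.
rewrite /cyl_prob /Gp_prob (big_pred1 F) => [|F'] /=; last first.
  rewrite andbT; apply/andP/eqP => [[F'G /eqP F'A]|->].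
    by apply: val_inj; rewrite /= FA -F'A; apply/esym/setIidPl.
  by rewrite FA (setIidPl AD).
rewrite /Gp_weight FA (big_setID A) (setIidPr AD) /=; congr (_ * _).
  by rewrite -prodr_const; apply: eq_bigr => e ->.
by rewrite -prodr_const; apply: eq_bigr => e; rewrite inE => /andP[/negPf->].
Qed.

Lemma le_cyl_prob B B' D A : subpred B B' -> cyl_prob B D A <= cyl_prob B' D A.
Proof.
move=> BB'; rewrite /cyl_prob /Gp_prob big_mkcond [leRHS]big_mkcond /=.
apply: ler_sum => F _; have [/and3P[-> -> /BB' -> //]|_] := ifP.
case: ifP => // _; apply: prodr_ge0 => e _; by case: ifP.
Qed.

Lemma Gp_probC B : Gp_prob p G B = 1 - Gp_prob p G (predC B).
Proof.
apply/eqP; rewrite eq_sym subr_eq; apply/eqP.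
have := @cyl_prob_predT set0 set0 (sub0set _) (sub0set _).
rewrite cyl_probT /cyl_weight setD0 cards0 !expr0 mulr1 => <-.
rewrite /Gp_prob (bigID B) /=.
by congr (_ + _); apply: eq_bigl => F; rewrite andbT.
Qed.

Lemma cyl_prob0 B D A : (forall F, A \subset edges F -> ~~ B F) -> cyl_prob B D A = 0.
Proof.
move=> AB; apply: big_pred0 => F; apply/negP => /and3P[_ /eqP FDA]; apply/negP/AB.
by rewrite -FDA subsetIl.
Qed.

(** * Depth-first search and its failure probability *)

Lemma sub_contains_path l (A : {set {set V}}) s F :
  A \subset edges F -> uniq s -> (l < size s)%N ->
  sorted (fun x y => [set x; y] \in A) s -> contains_path l F.
Proof.
move=> AF us ls ss; have sz : size (take l.+1 s) == l.+1 by rewrite size_takel.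
apply/existsP; exists (Tuple sz); rewrite /= take_uniq //=.
apply: sub_sorted (take_sorted _ ss) => x y; exact: (subsetP AF).
Qed.

(* One step of the exponential supermartingale. *)
Lemma exp_query_le (t x : R) :
  p * expR (x - t) + (1 - p) * expR x <= expR (x - p * (1 - expR (- t))).
Proof.
rewrite !expRD; set y := expR (- t); rewrite mulrCA [X in _ + X]mulrC -mulrDr.
(* With [expR x] factored out, this is 1 + u <= exp u for u = - p (1 - y). *)
rewrite ler_pM2l ?expR_gt0 //; apply: le_trans (expR_ge1Dx _).
lra.
Qed.

Variables (l m N : nat) (t : R).
Hypothesis t_ge0 : 0 <= t.
Hypothesis m_le : (m <= #|V|)%N.
(** Here [S] stands for the explored and [W] for the visited vertices when the search stops;
    [m <= #|S| + l] says that the stack has at most [l] vertices. *)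
Hypothesis boundary_ge : forall (S W : {set V}) (D : {set {set V}}),
  S \subset W -> #|W| = m -> (m <= #|S| + l)%N ->
  (forall x y, x \in S -> y \notin W -> adj G x y -> [set x; y] \in D) ->
  (N <= #|D|)%N.

(* A state of depth-first search: the explored vertices S, the stack s, the set
   D of edges exposed so far and the set A of those that turned out present. *)
Lemma dfs_bound n (S : {set V}) (s : seq V) D A :
  (#|edges G :\: D| + (m - (#|S| + size s)) * 2 + size s < n)%N ->
  A \subset D -> D \subset edges G -> uniq s -> {in s, forall x, x \notin S} ->
  sorted (fun x y => [set x; y] \in A) s ->
  (forall x y, x \in S -> y \notin S -> y \notin s -> adj G x y ->
     [set x; y] \in D) ->
  (#|A| <= #|S| + size s)%N -> (#|S| + size s <= m)%N ->
  cyl_prob (predC (contains_path l)) D A <= cyl_weight D A *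
    expR (p * (1 - expR (- t)) * (#|D|%:R - N%:R) + t * (m%:R - #|A|%:R)).
Proof.
set c := p * _.
(* The measure drops at each move: visiting a vertex costs 2 and lengthens the stack by 1, an
   exposure removes an edge, and a pop shortens the stack. *)
elim: n S s D A => // n IHn S s D A; rewrite ltnS => le_n AD DG us sS ss SD Acard le_m.
(* A stack longer than [l] is already a path in [A], so failure has probability 0. *)
have [ls|sl] := ltnP l (size s).
  rewrite cyl_prob0 => [|F AF].
    by apply: mulr_ge0; [exact: cyl_weight_ge0 | exact: expR_ge0].
  by rewrite /= negbK (sub_contains_path AF us ls ss).
have [ltm|gem] := ltnP (#|S| + size s) m; last first.
  have mE : (#|S| + size s = m)%N by apply/eqP; rewrite eqn_leq le_m.
  (* The search stops with [N <= #|D|] and [#|A| <= m], so the exponent is nonnegative and the full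
     weight of the cylinder is a sufficient bound. *)
  rewrite (le_trans (le_cyl_prob _ _ (B' := predT) _)) // cyl_prob_predT //.
  rewrite ler_peMr ?cyl_weight_ge0 // -[1 in leLHS]expR0 ler_expR.
  rewrite addr_ge0 ?mulr_ge0 ?subr_ge0 ?ler_nat //.
  - by rewrite expR_le1 oppr_le0.
  - apply: (boundary_ge (S := S) (W := S :|: [set x in s])).
    + exact: subsetUl.
    + rewrite cardsU disjoint_setI0 ?cards0 ?subn0 ?cardsE ?(card_uniqP us) //.
      by rewrite disjoint_sym disjoint_subset; apply/subsetP => x; rewrite inE => /sS.
    + by rewrite -mE leq_add2l.
    + by move=> x y xS; rewrite !inE negb_or => /andP[]; apply: SD.
  - by rewrite (leq_trans Acard).
case: s le_n us sS ss SD Acard le_m sl ltm => [|u s] le_n us sS ss SD Acard _ _ ltm.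
  (* The stack is empty: an unvisited vertex becomes a new root, and no edge is exposed. *)
  have [v vS] : exists v, v \notin S.
    apply/existsP; rewrite -negb_forall; apply/negP => /forallP ST.
    have := leq_trans ltm m_le; rewrite addn0 ltnNge => /negP; apply.
    by apply: subset_leq_card; apply/subsetP => x _; apply: ST.
  apply: (IHn S [:: v]) => //=.
  - move: le_n ltm => /=; clear; lia.
  - by move=> x; rewrite inE => /eqP ->.
  - by move=> x y xS yS _; apply: SD.
  - by rewrite (leq_trans Acard) // leq_add2l.
  - by move: ltm => /=; clear; lia.
have [/existsP[v /and4P[uv vS vs uvD]]|none] := boolP [exists v,
    [&& adj G u v, v \notin S, v \notin u :: s & [set u; v] \notin D]].
  have eG : [set u; v] |: D \subset edges G by rewrite subUset sub1set DG andbT.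
  have eA : [set u; v] \notin A by apply: contra uvD => /(subsetP AD).
  have lt_e : (#|edges G :\: ([set u; v] |: D)| < #|edges G :\: D|)%N.
    rewrite setUC -setDDl [ltnRHS](cardsD1 [set u; v]).
    by rewrite inE uvD; move: uv; rewrite /adj => ->.
  have SD' x y : x \in S -> y \notin S -> y \notin u :: s -> adj G x y ->
      [set x; y] \in [set u; v] |: D.
    by move=> xS yS ys xy; rewrite inE SD ?orbT.
  rewrite (cyl_prob_query _ uvD AD).
  have yes : cyl_prob (predC (contains_path l)) ([set u; v] |: D) ([set u; v] |: A)
    <= cyl_weight ([set u; v] |: D) ([set u; v] |: A) *
      expR (c * (#|[set u; v] |: D|%:R - N%:R)
            + t * (m%:R - #|[set u; v] |: A|%:R)).
    apply: (IHn S [:: v, u & s]) => //.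
    - move: le_n ltm lt_e => /=; clear; lia.
    - exact: setUS.
    - by rewrite cons_uniq vs.
    - by move=> x; rewrite inE => /predU1P[->//|/sS].
    - rewrite /= setUC setU11 /=.
      by apply: sub_path ss => x y; apply: (subsetP (subsetUr _ _)).
    - by move=> x y xS yS; rewrite inE negb_or => /andP[_]; apply: SD'.
    - by rewrite cardsU1 eA add1n /= addnS ltnS.
    - by rewrite /= addnS.
  have no : cyl_prob (predC (contains_path l)) ([set u; v] |: D) A
    <= cyl_weight ([set u; v] |: D) A *
      expR (c * (#|[set u; v] |: D|%:R - N%:R) + t * (m%:R - #|A|%:R)).
    apply: (IHn S (u :: s)) => //.
    - move: le_n lt_e => /=; clear; lia.
    - by rewrite (subset_trans AD) ?subsetUr.
    - exact: ltnW.
  apply: le_trans (lerD yes no) _.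
  rewrite !(cyl_weight_query uvD AD) !cardsU1 uvD eA !natrD.
  (* Relative to [x], the exponent is [x - c] before the exposure, [x - t] if the edge is present
     and [x] if it is absent, as in [exp_query_le]. *)
  set x := c * (1 + #|D|%:R - N%:R) + t * (m%:R - #|A|%:R).
  have -> : c * (1 + #|D|%:R - N%:R) + t * (m%:R - (1 + #|A|%:R)) = x - t.
    by rewrite /x; lra.
  have -> : c * (#|D|%:R - N%:R) + t * (m%:R - #|A|%:R) = x - c.
    by rewrite /x; lra.
  move: (cyl_weight D A) (cyl_weight_ge0 D A) => w w_ge0.
  rewrite ![_ * w]mulrC -!mulrA -mulrDr; apply: ler_wpM2l => //.
  exact: exp_query_le.
(* All edges from [u] to unvisited vertices are exposed, so [u] moves from the stack to the explored
   set. *)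
have uS : u \notin S by apply: sS; rewrite mem_head.
apply: (IHn (u |: S) s) => //.
- by move: le_n; rewrite cardsU1 uS /=; clear; lia.
- by case/andP: us.
- move=> x xs; rewrite !inE negb_or (sS x) ?inE ?xs ?orbT // andbT.
  by apply: contraNneq (andP us).1 => <-.
- exact: path_sorted ss.
- move=> x y; rewrite !inE negb_or => xS /andP[yu yS] ys xy.
  have yus : y \notin u :: s by rewrite inE negb_or yu.
  case/predU1P: xS => [xu|xS]; last exact: SD.
  apply: contraNT none => xyD; apply/existsP; exists y.
  by rewrite -xu xy yS xyD xu yus.
- by rewrite cardsU1 uS; move: Acard => /=; clear; lia.
- by rewrite cardsU1 uS; move: ltm => /=; clear; lia.
Qed.

Lemma Gp_prob_path_ge :
  1 - expR (t * m%:R - p * (1 - expR (- t)) * N%:R)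
    <= Gp_prob p G (contains_path l).
Proof.
rewrite Gp_probC lerB // -cyl_probT.
have := @dfs_bound _ set0 [::] set0 set0 (ltnSn _).
rewrite /cyl_weight setD0 cards0 !expr0 !mul1r subr0 sub0r mulrN addrC.
by apply; rewrite ?sub0set ?cards0 // => x y; rewrite inE.
Qed.

End Cylinders.

(** * Counting exposed edges and the Chernoff estimate *)

(** The degrees in [S] sum to at least [k * (m - l)], and at most [M] of this stays inside [W]. The
    rest counts distinct edges, as each has just one end in [W]. *)
Lemma boundary_card_ge (V : finType) (G : sgraph V) (k l m M : nat)
    (S W : {set V}) (D : {set {set V}}) :
  (forall x, k <= degree G x)%N ->
  (\sum_(x in W) #|[set y in W | adj G x y]| <= M)%N ->
  S \subset W -> #|W| = m -> (m <= #|S| + l)%N ->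
  (forall x y, x \in S -> y \notin W -> adj G x y -> [set x; y] \in D) ->
  (k * (m - l) - M <= #|D|)%N.
Proof.
move=> degG innerM SW Wm Sl SD.
pose out x := [set y | (y \notin W) && adj G x y].
have outD : (\sum_(x in S) #|out x| <= #|D|)%N.
  under eq_bigr do rewrite -sum1dep_card.
  rewrite pair_big_dep /= sum1dep_card -(card_in_imset (f := fun u => [set u.1; u.2])).
    apply: subset_leq_card; apply/subsetP => _ /imsetP[[x y] + ->].
    by rewrite inE /= => /and3P[xS yW xy]; apply: SD.
  move=> [x y] [x' y']; rewrite !inE /= => /and3P[xS yW _] /and3P[xS' yW' _].
  case/set2_eq => -[xE yE]; first by rewrite xE yE.
  by rewrite xE in xS; rewrite (subsetP SW _ xS) in yW'.
rewrite leq_subLR; apply: leq_trans (leq_add innerM outD).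
apply: (@leq_trans (\sum_(x in S) degree G x)).
  apply: (@leq_trans (k * #|S|)); first by rewrite leq_mul2l leq_subLR addnC Sl orbT.
  by rewrite mulnC -sum_nat_const; apply: leq_sum => x _; apply: degG.
apply: (@leq_trans (\sum_(x in S) (#|[set y in W | adj G x y]| + #|out x|))).
  apply: leq_sum => x _; rewrite /degree -(cardsID W) leq_add //.
    by apply: subset_leq_card; apply/subsetP => y; rewrite !inE andbC.
  by apply: subset_leq_card; apply/subsetP => y; rewrite !inE.
rewrite big_split /= leq_add2r [leqRHS](big_setID S) /= (setIidPr SW).
exact: leq_addr.
Qed.

(** With t = e / 6, one has p N >= m (1 + 2t) and 1 - exp(-t) >= t / (1 + t), so the left side is at
    most - m t^2 / (1 + t) = - e^2 m / (36 + 6 e); finally e < 1 gives 42. *)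
Lemma chernoff_exponent (R : realType) (e p k m N : R) :
  0 < e < 1 -> 0 < k -> (1 + e) / k <= p -> 0 <= m -> 0 <= N ->
  k * m * (1 + e / 3) <= (1 + e) * N ->
  e / 6 * m - p * (1 - expR (- (e / 6))) * N <= - (e ^+ 2 * m / 42).
Proof.
move=> /andP[e0 e1] k0 kp m0 N0 mN.
have pN : m * (1 + e / 3) <= p * N.
  apply: le_trans (ler_wpM2r N0 kp).
  by rewrite mulrAC ler_pdivlMr // mulrC mulrA.
have pN0 : 0 <= p * N by apply: le_trans pN; rewrite mulr_ge0 //; lra.
have t0 : 0 < 1 + e / 6 by lra.
have expN : e / 6 / (1 + e / 6) <= 1 - expR (- (e / 6)).
  rewrite expRN lerBrDr -lerBrDl.
  have -> : 1 - e / 6 / (1 + e / 6) = (1 + e / 6)^-1 by field; lra.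
  by rewrite lef_pV2 ?posrE ?expR_gt0 ?expR_ge1Dx.
have step : m * (1 + e / 3) * (e / 6 / (1 + e / 6))
    <= p * (1 - expR (- (e / 6))) * N.
  rewrite [leRHS]mulrAC; apply: ler_pM => //; first by rewrite mulr_ge0 //; lra.
  by rewrite divr_ge0; lra.
apply: le_trans (lerB (lexx _) step) _.
have -> : e / 6 * m - m * (1 + e / 3) * (e / 6 / (1 + e / 6)) =
    - (e ^+ 2 * m / (36 + 6 * e)).
  by field; lra.
rewrite lerN2; apply: ler_wpM2l; first by rewrite mulr_ge0 ?sqr_ge0.
by rewrite lef_pV2 ?posrE; lra.
Qed.

(** Serves both choices of [m]. The inequality with [1 + e / 3] makes the expected number of present
    edges among those exposed exceed [m] by that factor. *)
Lemma Gp_prob_path_of_sparse (R : realType) (V : finType) (G : sgraph V) (p e : R)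
    (k l m M : nat) :
  0 < e < 1 -> 0 <= p <= 1 -> (0 < k)%N -> (1 + e) / k%:R <= p ->
  (forall x, k <= degree G x)%N -> (m <= #|V|)%N ->
  (forall W : {set V}, #|W| = m ->
     \sum_(x in W) #|[set y in W | adj G x y]| <= M)%N ->
  k%:R * m%:R * (1 + e / 3) <= (1 + e) * (k%:R * (m%:R - l%:R) - M%:R) ->
  7 / 50 * e * k%:R <= m%:R ->
  1 - expR (- (e ^+ 3 * k%:R / 300)) <= Gp_prob p G (contains_path l).
Proof.
move=> e01 p01 k0 kp degG mV sparse large mk; have /andP[e0 e1] := e01.
have t0 : 0 <= e / 6 by lra.
have bd S W D SW Wm Sl SD :=
  @boundary_card_ge V G k l m M S W D degG (sparse W Wm) SW Wm Sl SD.
apply: le_trans (Gp_prob_path_ge p01 t0 mV bd).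
rewrite lerB // ler_expR.
have subR a c : a%:R - c%:R <= (a - c)%N%:R :> R.
  have [ca|ac] := leqP c a; first by rewrite natrB.
  by rewrite (eqP (ltnW ac)) subr_le0 ler_nat ltnW.
have NR : k%:R * (m%:R - l%:R) - M%:R <= (k * (m - l) - M)%:R :> R.
  apply: le_trans (subR _ _); rewrite lerB // natrM ler_wpM2l //.
apply: le_trans (@chernoff_exponent R e p k%:R m%:R _ e01 _ kp _ _ _) _ => //.
- by rewrite ltr0n.
- by apply: le_trans large _; rewrite ler_wpM2l //; lra.
(* The constants fit because (7 / 50) / 42 = 1 / 300. *)
rewrite lerN2 exprSr; have : 0 <= e ^+ 2 by rewrite sqr_ge0.
move: (e ^+ 2) => e2 e20; have := ler_wpM2l e20 mk; lra.
Qed.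

(** * Choice of the number of visited vertices *)

Lemma natr_ceil_itv (R : realType) (x : R) : 0 <= x ->
  x <= `|Num.ceil x|%N%:R < x + 1.
Proof.
move=> x0; have c0 : 0 <= Num.ceil x by rewrite -(ceil0 R) le_ceil.
rewrite -[_%:R]/((`|Num.ceil x|%N : int)%:~R) gez0_abs // ceil_ge /=.
by have := ceilB1_lt x; rewrite intrB ltrBlDr.
Qed.

Theorem theorem1p4 (R : realType) (eps : R) (k : int)
    (I : finType) (U : I -> finType) (H : forall i : I, sgraph (U i))
    (l : nat) (V : finType) (G : sgraph V) (p : R) :
  0 < eps < 1 ->
  good_family H ->
  (0 < l)%N ->
  (ex_num H `|Num.ceil (6 * l%:R / eps)|%N)%:R / l%:R <= k%:~R / 2 :> R ->
  family_free H G ->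
  k <= (min_degree G)%:Z ->
  0 <= p <= 1 ->
  (1 + eps) / k%:~R <= p ->
  1 - 3 * expR (- (eps ^+ 3 * k%:~R / 300)) <= Gp_prob p G (contains_path l).
Proof.
move=> eps01 Hgood l0 exk Gfree kdeg p01 kp; have /andP[e0 e1] := eps01.
have Hconn i : connected_graph (H i) by have [] := Hgood i.
(* For an exponent x <= 2/3 the claim is trivial, as 3 exp(-x) >= 3 (1 - x) >= 1. Otherwise [k] is
   forced to be positive. *)
have [small|large] := lerP (eps ^+ 3 * k%:~R / 300) (2 / 3).
  apply: le_trans (Gp_prob_ge0 G p01 _).
  have := expR_ge1Dx (- (eps ^+ 3 * k%:~R / 300)); lra.
have k0 : 0 < k%:~R :> R.
  rewrite -(pmulr_rgt0 _ (exprn_gt0 3 e0)); lra.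
case: k k0 exk kdeg kp large => [k|k]; last by rewrite ltr0z.
rewrite -pmulrn ltr0n => k0 exk kdeg kp large.
have degG x : (k <= degree G x)%N := leq_trans kdeg (min_degree_le G x).
suff : 1 - expR (- (eps ^+ 3 * k%:R / 300)) <= Gp_prob p G (contains_path l).
  apply: le_trans; have := expR_gt0 (- (eps ^+ 3 * k%:R / 300)); lra.
have kR0 : 0 < k%:R :> R by rewrite ltr0n.
have lR0 : 0 < l%:R :> R by rewrite ltr0n.
(* Since eps^3 k > 200 and eps < 1, rounding eps k up costs little. *)
have ek : 200 <= eps * k%:R.
  have : eps ^+ 2 <= 1 by rewrite expr_le1 // ltW.
  rewrite -(ler_pM2r (mulr_gt0 e0 kR0)) mul1r mulrA -exprSr; lra.
set m := `|Num.ceil (6 * l%:R / eps)|%N in exk.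
have lm : 6 * l%:R <= eps * m%:R.
  rewrite -ler_pdivrMl // mulrC.
  have x0 : 0 <= 6 * l%:R / eps by apply: divr_ge0; [rewrite mulr_ge0 | exact: ltW].
  by have /andP[] := natr_ceil_itv x0.
have lm_nat : (6 * l <= m)%N.
  rewrite -(ler_nat R) natrM; apply: le_trans lm _.
  by rewrite ler_piMl // ltW.
have ex_le : (ex_num H m * 2 <= k * l)%N.
  rewrite -(ler_nat R) !natrM.
  by move: exk; rewrite ler_pdivrMr // mulrAC ler_pdivlMr.
(* On an empty vertex set [min_degree] takes its default value [#|V|], which is 0 and thus below
   [k]. *)
have V0 : (0 < #|V|)%N.
  apply: contraTT k0; rewrite -!leqNgt leqn0 => /eqP V0; apply: leq_trans kdeg _.
  by rewrite /min_degree big_pred0 ?V0 // => x; have := card0_eq V0 x; rewrite inE.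
have [mk|mk] := lerP (7 / 50 * eps * k%:R) m%:R.
  (* If [#|V| < m], the complete copies of [G] fill more than half of the [m] vertices, while the
     edge bound allows them at most [l <= m / 6]. *)
  have mV : (m <= #|V|)%N.
    rewrite leqNgt; apply/negP => Vm.
    have := leq_trans (ex_num_copies m Hconn Gfree V0 degG) ex_le.
    rewrite mulnC leq_pmul2l // => ql.
    have := divn_eq m #|V|; have := ltn_pmod m V0.
    have : (#|V| <= m %/ #|V| * #|V|)%N by rewrite leq_pmull // divn_gt0 // ltnW.
    move: ql lm_nat l0; clear; lia.
  have sparse (W : {set V}) : #|W| = m ->
      (\sum_(x in W) #|[set y in W | adj G x y]| <= k * l)%N.
    by move=> Wm; have := sum_inner_degree_le W Hconn Gfree; rewrite Wm => /leq_trans; apply.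
  apply: (Gp_prob_path_of_sparse eps01 p01 k0 kp degG mV sparse _ mk).
  rewrite natrM -subr_ge0.
  (* The slack is a sum of two terms, nonnegative by [lm] and by [eps < 1]. *)
  have -> : (1 + eps) * (k%:R * (m%:R - l%:R) - k%:R * l%:R)
      - k%:R * m%:R * (1 + eps / 3) =
    k%:R * ((1 + eps) * (eps * m%:R - 6 * l%:R) / 3 + (1 - eps) * (eps * m%:R) / 3).
    by field.
  have em0 : 0 <= eps * m%:R by rewrite mulr_ge0 // ltW.
  apply: mulr_ge0; first exact: ltW.
  by rewrite addr_ge0 // mulr_ge0 ?invr_ge0 // mulr_ge0 ?subr_ge0 //; lra.
pose n := `|Num.ceil (7 / 50 * eps * k%:R)|%N.
have /andP[kn nk] : 7 / 50 * eps * k%:R <= n%:R < 7 / 50 * eps * k%:R + 1.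
  by apply: natr_ceil_itv; lra.
have ln : 6 * l%:R <= eps * n%:R.
  by apply: le_trans lm _; rewrite ler_pM2l // ltW // (lt_le_trans mk).
(* Rounding up adds less than 1, and 3/20 - 7/50 = 1/100 while [eps * k] is at least 200. *)
have nk' : n%:R <= 3 / 20 * (eps * k%:R) by lra.
have nV : (n <= #|V|)%N.
  have /card_gt0P[x _] := V0.
  apply: (@leq_trans k).
    rewrite -(ler_nat R); apply: le_trans nk' _.
    have : eps * k%:R <= 1 * k%:R by rewrite ler_pM2r // ltW.
    lra.
  by apply: leq_trans (degG x) _; exact: max_card.
have dense (W : {set V}) : #|W| = n ->
    (\sum_(x in W) #|[set y in W | adj G x y]| <= n * n)%N.
  move=> Wn; rewrite -{1}Wn -sum_nat_const; apply: leq_sum => x _.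
  by rewrite -Wn; apply: subset_leq_card; apply/subsetP => y; rewrite inE => /andP[].
apply: (Gp_prob_path_of_sparse eps01 p01 k0 kp degG nV dense _ kn).
have n0 : 0 <= n%:R :> R by [].
rewrite natrM -subr_ge0.
(* The slack is a sum of three terms, nonnegative by [ln], by [nk'] and by [eps < 1]. *)
have -> : (1 + eps) * (k%:R * (n%:R - l%:R) - n%:R * n%:R)
    - k%:R * n%:R * (1 + eps / 3) =
  k%:R * (1 + eps) * (eps * n%:R - 6 * l%:R) / 6
  + (1 + eps) * n%:R * (3 / 20 * (eps * k%:R) - n%:R)
  + k%:R * n%:R * eps * (21 - 19 * eps) / 60.
  by field.
have e1' : 0 <= 1 + eps by lra.
have e2' : 0 <= 21 - 19 * eps by lra.
by apply: addr_ge0; first apply: addr_ge0; rewrite ?mulr_ge0 ?invr_ge0 // ?subr_ge0 // ltW.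
Qed.
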